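(* Let $X$ be a locally compact Hausdorff space and let $f$ be a homeomorphism of $X$. If $\langle f\rangle$ is pointwise almost periodic on $X$, then so is every virtually polycyclic subgroup $G$ of $\tau[f]$.
   Context: For a homeomorphism $f$ of $X$, the topological full group $\tau[f]$ is the group of all homeomorphisms $h$ of $X$ for which there is a locally constant function $c:X\to\mathbb{Z}$ with $hx=f^{c(x)}x$ for all $x\in X$. A group is polycyclic if it admits a subnormal series with finitely many factors, each cyclic; it is virtually polycyclic if it has a polycyclic subgroup of finite index. A subset $S$ of a group $G$ is left syndetic if $G=FS$ for some finite subset $F$ of $G$. For a group $G$ of homeomorphisms of a Hausdorff space $X$, $x\in X$ and a neighbourhood $U$ of $x$, put $R_G(x,U):=\{g\in G\mid gx\in U\}$. $G$ is almost periodic at $x$ if $R_G(x,U)$ is a left syndetic subset of $G$ for every neighbourhood $U$ of $x$, and $G$ is pointwise almost periodic on $X$ if it is almost periodic at every point of $X$. *)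

(* Defs.v *)
From HB Require Import structures.
From mathcomp Require Import all_boot all_order all_algebra.
From mathcomp Require Import all_classical all_analysis.

Set Implicit Arguments.
Unset Strict Implicit.
Unset Printing Implicit Defensive.

Local Open Scope classical_set_scope.
Local Open Scope group_scope.

(* MathComp's group theory beyond [groupType] is about finite groups, so
   subgroups of an arbitrary group are handled here as sets [G : set T]. *)
Section AbstractGroups.
Variable T : groupType.
Implicit Types (x g h : T) (G H N S : set T).

Definition expgz x (k : int) : T :=
  match k with
  | Posz n => x ^+ n
  | Negz n => x ^- n.+1
  end.

Definition subgroup G : Prop :=
  [/\ G 1,
      forall g h, G g -> G h -> G (g * h) &
      forall g, G g -> G g^-1].

Definition cyclic_subgroup x : set T := range (expgz x).

Definition left_coset x H : set T := [set x * h | h in H].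

Definition left_cosets H G : set (set T) := [set left_coset x H | x in G].

Definition normal_subgroup N G : Prop :=
  [/\ subgroup N, N `<=` G & forall g h, G g -> N h -> N (h ^ g)].

(* G / N is cyclic for N normal in G: since (g N)^k = g^k N, some coset g N
   generates the set of all cosets. *)
Definition cyclic_factor N G : Prop :=
  exists2 g, G g &
    left_cosets N G = range (fun k : int => left_coset (expgz g k) N).

Definition polycyclic G : Prop :=
  subgroup G /\
  exists (n : nat) (H : nat -> set T),
    [/\ H 0 = [set 1],
        H n = G &
        forall i : nat, (i < n)%N ->
          [/\ subgroup (H i.+1),
              normal_subgroup (H i) (H i.+1) &
              cyclic_factor (H i) (H i.+1)]].

Definition virtually_polycyclic G : Prop :=
  subgroup G /\
  exists H, [/\ H `<=` G, polycyclic H & finite_set (left_cosets H G)].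

Definition left_syndetic G S : Prop :=
  S `<=` G /\
  exists F, [/\ finite_set F, F `<=` G & G = [set a * s | a in F & s in S]].

End AbstractGroups.

Record homeo (X : topologicalType) := Homeo {
  homeo_fun :> X -> X;
  homeo_inv : X -> X;
  homeo_funK : cancel homeo_fun homeo_inv;
  homeo_invK : cancel homeo_inv homeo_fun;
  homeo_fun_continuous : continuous homeo_fun;
  homeo_inv_continuous : continuous homeo_inv }.

Section HomeoGroup.
Variable X : topologicalType.
Implicit Types f g h : homeo X.

Lemma homeo_ext f g : (forall x, f x = g x) -> f = g.
Proof.
case: f g => [f f' fK f'K cf cf'] [g g' gK g'K cg cg'] /= fg.
have efg : f = g by apply/funext.
move: fK f'K cf; rewrite efg => fK f'K cf.
have efg' : f' = g' by apply/funext => x; rewrite -{1}(g'K x) fK.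
move: fK f'K cf'; rewrite efg' => fK f'K cf'.
by congr Homeo; exact: Prop_irrelevance.
Qed.

Definition homeo_one : homeo X :=
  @Homeo X id id (fun _ => erefl) (fun _ => erefl)
    (fun _ => cvg_id) (fun _ => cvg_id).

Definition homeo_inverse f : homeo X :=
  Homeo (@homeo_invK _ f) (@homeo_funK _ f)
    (@homeo_inv_continuous _ f) (@homeo_fun_continuous _ f).

Lemma homeo_comp_continuous f g : continuous (f \o g).
Proof.
by move=> x; apply: continuous_comp; exact: homeo_fun_continuous.
Qed.

Lemma homeo_comp_inv_continuous f g :
  continuous (homeo_inv g \o homeo_inv f).
Proof.
by move=> x; apply: continuous_comp; exact: homeo_inv_continuous.
Qed.

Definition homeo_mul f g : homeo X :=
  Homeo (can_comp (@homeo_funK _ f) (@homeo_funK _ g))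
    (can_comp (@homeo_invK _ g) (@homeo_invK _ f))
    (@homeo_comp_continuous f g) (@homeo_comp_inv_continuous f g).

HB.instance Definition _ := gen_eqMixin (homeo X).
HB.instance Definition _ := gen_choiceMixin (homeo X).

Let homeo_mulA : associative homeo_mul.
Proof. by move=> f g h; exact: homeo_ext. Qed.

Let homeo_mul1 : left_id homeo_one homeo_mul.
Proof. by move=> f; exact: homeo_ext. Qed.

Let homeo_mulr1 : right_id homeo_one homeo_mul.
Proof. by move=> f; exact: homeo_ext. Qed.

Let homeo_mulV : left_inverse homeo_one homeo_inverse homeo_mul.
Proof. by move=> f; apply: homeo_ext => x; exact: homeo_funK. Qed.

Let homeo_mulrV : right_inverse homeo_one homeo_inverse homeo_mul.
Proof. by move=> f; apply: homeo_ext => x; exact: homeo_invK. Qed.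

HB.instance Definition _ := isGroup.Build (homeo X)
  homeo_mulA homeo_mul1 homeo_mulr1 homeo_mulV homeo_mulrV.

Lemma homeo_mulE f g x : (f * g) x = f (g x).
Proof. by []. Qed.

Definition locally_constant (c : X -> int) : Prop :=
  forall x, \forall y \near x, c y = c x.

Definition topological_full_group f : set (homeo X) :=
  [set h | exists2 c : X -> int,
     locally_constant c & forall x, h x = expgz f (c x) x].

Definition return_set (G : set (homeo X)) (x : X) (U : set X) :
  set (homeo X) := [set g | G g /\ U (g x)].

Definition almost_periodic_at (G : set (homeo X)) (x : X) : Prop :=
  forall U : set X, nbhs x U -> left_syndetic G (return_set G x U).

Definition pointwise_almost_periodic (G : set (homeo X)) : Prop :=
  forall x, almost_periodic_at G x.

End HomeoGroup.

(* Main.v *)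
(* Virtually polycyclic groups are finitely generated, which is how the
   hypothesis enters.  Fix an open neighbourhood U of x, and turn the f-orbit of x into a graph on the
   integers: n is joined to n + c_s(n) for every generator s of G, where
   s f^n x = f^(n + c_s(n)) x.  Compactness of the closure of the f-orbit bounds
   the jumps of this graph, and almost periodicity of <f> makes every finite
   pattern in it recur with bounded gaps.  Let W be the set of n such that the
   G-orbit of f^n x meets U; it is a union of components.  Take k maximal such
   that every window of integers is crossed by k strands lying in distinct
   components of the window and missing W.  Some window is not crossed by k + 1
   such strands, hence by recurrence no long window is, even when W is replaced
   by a suitable part of W on which U is reached by finitely many elements of G.
   So a strand from W crossing a long window must reach that part of W inside the
   window: it would otherwise be a (k+1)-st strand.  Therefore every point of G x
   is moved into U by an element from a fixed finite subset of G. *)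
Require Import Defs.
From mathcomp Require Import all_boot all_order all_algebra.
From mathcomp Require Import all_classical all_analysis.
From mathcomp Require Import zify.
Import Order.TTheory GRing.Theory Num.Theory.
Local Open Scope classical_set_scope.

(** * Finite windows of integers *)

Section Windows.
Local Open Scope ring_scope.

Definition in_window (lo hi : int) : pred int := fun u => (lo <= u) && (u < hi).

Lemma window_enum lo hi :
  exists w : seq int, forall u, in_window lo hi u -> u \in w.
Proof.
exists [seq lo + i%:Z | i <- iota 0 `|hi - lo|] => u; rewrite /in_window => Hu.
by apply/mapP; exists `|u - lo|%N; [rewrite mem_iota|]; lia.
Qed.

End Windows.

(** * Strands in a symmetric graph on the integers with bounded jumps *)

Section Strands.
Local Open Scope ring_scope.
Variables (e : rel int) (D : int).
Hypothesis e_sym : symmetric e.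
Hypothesis e_bounded : forall u v, e u v -> u - D <= v <= u + D.
Hypothesis D_gt0 : 0 < D.

Definition linked (lo hi u v : int) : Prop :=
  exists p, [/\ path e u p, last u p = v & all (in_window lo hi) (u :: p)].

Lemma linked_refl lo hi u : in_window lo hi u -> linked lo hi u u.
Proof. by move=> Hu; exists [::]; split => //=; rewrite Hu. Qed.

Lemma linked_in lo hi u v :
  linked lo hi u v -> in_window lo hi u /\ in_window lo hi v.
Proof.
by move=> [p [_ <- /allP H]]; split; apply: H; rewrite ?mem_head ?mem_last.
Qed.

Lemma linked_trans {lo hi u v w} :
  linked lo hi u v -> linked lo hi v w -> linked lo hi u w.
Proof.
move=> [p [Pp Lp Ap]] [q [Pq Lq Aq]]; exists (p ++ q); split.
- by rewrite cat_path Pp Lp.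
- by rewrite last_cat Lp.
- by move: Ap Aq => /= /andP[-> Ap] /andP[_ Aq]; rewrite all_cat Ap Aq.
Qed.

Lemma linked_sym {lo hi u v} : linked lo hi u v -> linked lo hi v u.
Proof.
move=> [p [Pp Lp Ap]]; exists (rev (belast u p)); split.
- by rewrite -Lp rev_path (eq_path (e' := e)) // => a b; exact: e_sym.
- by rewrite -Lp; case: p {Pp Lp Ap} => //= y p; rewrite rev_cons last_rcons.
- by rewrite -Lp -rev_rcons -lastI all_rev.
Qed.

Lemma linked_sub {lo hi lo' hi' u v} : lo' <= lo -> hi <= hi' ->
  linked lo hi u v -> linked lo' hi' u v.
Proof.
move=> Hlo Hhi [p [Pp Lp Ap]]; exists p; split => //.
by apply: sub_all Ap => w; rewrite /in_window; lia.
Qed.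

Lemma path_cut_low lo u p : path e u p -> lo <= last u p ->
  exists u' p', [/\ path e u' p', last u' p' = last u p,
    all (>= lo) (u' :: p'), {subset u' :: p' <= u :: p} &
    (u' = u /\ p' = p) \/ u' < lo + D].
Proof.
elim: p u => [|y p IH] u /=.
  by move=> _ Hu; exists u, [::]; split => //=; [rewrite Hu|left].
case/andP => Huy Pp Hl.
have [u' [p' [Pp' Lp' Ap' Sp' H]]] := IH y Pp Hl.
have Ss : {subset u' :: p' <= [:: u, y & p]}.
  by move=> w /Sp' Hw; rewrite inE Hw orbT.
case: H => [[E1 E2]|H]; last by exists u', p'; split => //; right.
subst u' p'.
have [Hu|Hu] := leP lo u.
  by exists u, (y :: p); split => //=; [rewrite Huy Pp|rewrite Hu|left].
exists y, p; split => //; right.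
by have := e_bounded _ _ Huy; lia.
Qed.

(** Stop at the first vertex that is at least [hi - D]: its predecessor, if any, is smaller, so one
    jump cannot reach [hi]. *)
Lemma path_cut_high hi u p : path e u p -> u < hi -> hi - D <= last u p ->
  exists p', [/\ path e u p', hi - D <= last u p',
    all (< hi) (u :: p') & {subset u :: p' <= u :: p}].
Proof.
elim: p u => [|y p IH] u /=.
  by move=> _ Hu Hl; exists [::]; split => //=; rewrite Hu.
case/andP => Huy Pp Hu Hl.
have [H|H] := leP (hi - D) u.
  exists [::]; split => //=; first by rewrite Hu.
  by move=> w; rewrite !inE => ->.
have Hy : y < hi by have := e_bounded _ _ Huy; lia.
have [p' [Pp' Lp' Ap' Sp']] := IH y Pp Hy Hl.
exists (y :: p'); split => //.
- by rewrite /= Huy.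
- by move: Ap' => /= ->; rewrite Hu.
- by move=> w; rewrite !inE => /predU1P[->|/Sp']; rewrite ?eqxx // inE => ->; rewrite orbT.
Qed.

Lemma path_exit lo hi u p : path e u p -> in_window lo hi u ->
  linked lo hi u (last u p) \/
  exists2 v, linked lo hi u v & (hi - D <= v) || (v < lo + D).
Proof.
elim: p u => [|y p IH] u /=; first by move=> _ Hu; left; exact: linked_refl.
case/andP => Huy Pp Hu.
have B := e_bounded _ _ Huy.
have [Hy|Hy] := boolP (in_window lo hi y); last first.
  by right; exists u; [exact: linked_refl|move: Hu Hy; rewrite /in_window; lia].
have L : linked lo hi u y by exists [:: y]; split; rewrite /= ?Huy ?Hu ?Hy.
case: (IH _ Pp Hy) => [H|[v H Hv]]; first by left; exact: linked_trans H.
by right; exists v => //; exact: linked_trans H.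
Qed.

(** A path with jumps of at most [D] cannot leap over a margin of width [D], hence the tolerance at
    both ends. *)
Definition crossing (lo hi u : int) : Prop :=
  u < lo + D /\ exists2 v, hi - D <= v & linked lo hi u v.

Lemma crossing_sub lo hi lo' hi' u : lo <= lo' -> hi' <= hi -> lo' + D <= hi' ->
  crossing lo hi u -> exists2 u', crossing lo' hi' u' & linked lo hi u u'.
Proof.
move=> Hlo Hhi HD [Hu [v Hv Huv]].
have [p [Pp Lp /allP Ap]] := Huv.
have Hl : lo' <= last u p by lia.
have [u' [q [Pq Lq Aq Sq H]]] := path_cut_low _ _ _ Pp Hl.
have Hu' : u' < lo' + D by case: H => [[-> _]|]; lia.
have Hl' : hi' - D <= last u' q by lia.
have Hu'' : u' < hi' by lia.
have [r [Pr Lr /allP Ar Sr]] := path_cut_high _ _ _ Pq Hu'' Hl'.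
exists u'.
  split => //; exists (last u' r) => //; exists r; split => //.
  apply/allP => w Hw; have := Ar _ Hw; have := allP Aq _ (Sr _ Hw).
  by rewrite /in_window /= => -> ->.
apply: linked_trans Huv _; apply: linked_sym; exists q; split => //.
  by rewrite Lq.
by apply/allP => w /Sq /Ap.
Qed.

Definition strands (lo hi : int) (A : int -> Prop) (k : nat) : Prop :=
  exists s : seq int, [/\ size s = k, uniq s,
    (forall u, u \in s -> crossing lo hi u),
    (forall u v, u \in s -> linked lo hi u v -> ~ A v) &
    (forall u v, u \in s -> v \in s -> linked lo hi u v -> u = v)].

(** Each strand is cut down by [crossing_sub]. The pieces stay in distinct components and avoid [A]
    because a link in the smaller window is a link in the larger one. *)
Lemma strands_sub lo hi lo' hi' (A : int -> Prop) k :
  lo <= lo' -> hi' <= hi -> lo' + D <= hi' ->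
  strands lo hi A k -> strands lo' hi' A k.
Proof.
move=> Hlo Hhi HD [s [Ss Us Cs As Ls]].
have /choice[phi Hphi] : forall u, exists u', u \in s ->
    crossing lo' hi' u' /\ linked lo hi u u'.
  move=> u; have [/Cs/crossing_sub|_] := boolP (u \in s); last by exists 0.
  by move=> /(_ lo' hi' Hlo Hhi HD)[u' ? ?]; exists u'.
have inj u v : u \in s -> v \in s -> linked lo hi (phi u) (phi v) -> u = v.
  move=> us vs L; apply: Ls => //.
  apply: linked_trans (Hphi _ us).2 _; apply: linked_trans L _.
  exact: linked_sym (Hphi _ vs).2.
exists (map phi s); split.
- by rewrite size_map.
- rewrite map_inj_in_uniq // => u v us vs E; apply: inj => //.
  rewrite E; apply: linked_refl.
  by have [] := linked_in _ _ _ _ (Hphi _ vs).2.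
- by move=> _ /mapP[u us ->]; exact: (Hphi _ us).1.
- move=> _ w /mapP[u us ->] L; apply: (As u) => //.
  exact: linked_trans (Hphi _ us).2 (linked_sub Hlo Hhi L).
- move=> _ _ /mapP[u us ->] /mapP[v vs ->] L; congr phi; apply: inj => //.
  exact: linked_sub L.
Qed.

Lemma uniq_window_size lo (n : nat) (s : seq int) : uniq s ->
  (forall u, u \in s -> in_window lo (lo + n%:Z) u) -> (size s <= n)%N.
Proof.
move=> Us Hs; rewrite -(size_iota 0 n) -(size_map (fun i : nat => lo + i%:Z)).
apply: uniq_leq_size => // u /Hs; rewrite /in_window => Hu.
apply/mapP; exists `|u - lo|%N; last by lia.
by rewrite mem_iota; lia.
Qed.

(** Strands start at distinct integers among the first [D] of the window. *)
Lemma strands_bounded lo hi A k : strands lo hi A k -> (k <= `|D|)%N.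
Proof.
move=> [s [<- Us Cs _ _]]; apply: (uniq_window_size lo) => // u /Cs[Hu [v _]].
by move=> /linked_in[]; rewrite /in_window; lia.
Qed.

(** Strands are pulled back along an isomorphism of induced graphs. Carrying [A] forward suffices: a
    pulled-back strand meeting [A] would come from a strand meeting [A]. *)
Lemma strands_translate lo hi t (A : int -> Prop) k :
  (forall u v, in_window lo hi u -> in_window lo hi v ->
     e (u + t) (v + t) = e u v) ->
  (forall u, in_window lo hi u -> A u -> A (u + t)) ->
  strands (lo + t) (hi + t) A k -> strands lo hi A k.
Proof.
move=> He HA.
have sub u p : all (in_window lo hi) (u :: p) ->
    path e (u + t) (map (+%R^~ t) p) = path e u p.
  by elim: p u => //= y p IH u /and3P[Hu Hy Hp]; rewrite He // IH //= Hy.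
have map_linked u v : linked lo hi u v -> linked (lo + t) (hi + t) (u + t) (v + t).
  move=> [p [Pp Lp Ap]]; exists (map (+%R^~ t) p); split.
  - by rewrite sub.
  - by rewrite (last_map (+%R^~ t)) Lp.
  - rewrite -(map_cons (+%R^~ t)) all_map; apply: sub_all Ap => w /=.
    by rewrite /in_window; lia.
have linked_map u v : linked (lo + t) (hi + t) u v -> linked lo hi (u - t) (v - t).
  move=> [p [Pp Lp Ap]].
  have Aq : all (in_window lo hi) (map (+%R^~ (- t)) (u :: p)).
    rewrite all_map; apply: sub_all Ap => w /=; rewrite /in_window; lia.
  exists (map (+%R^~ (- t)) p); split => //.
  - rewrite -sub // subrK -map_comp map_id_in // => w _ /=; exact: subrK.
  - by rewrite (last_map (+%R^~ (- t))) Lp.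
move=> [s [Ss Us Cs As Ls]]; exists (map (+%R^~ (- t)) s); split.
- by rewrite size_map.
- by rewrite map_inj_uniq //; exact: addIr.
- move=> _ /mapP[u us ->]; have [Hu [v Hv L]] := Cs _ us.
  by split; [lia|exists (v - t); [lia|exact: linked_map]].
- move=> _ w /mapP[u us ->] L Aw.
  have := map_linked _ _ L; rewrite subrK => /As; apply => //.
  by apply: HA => //; case: (linked_in _ _ _ _ L).
- move=> _ _ /mapP[u us ->] /mapP[v vs ->] /map_linked; rewrite !subrK => /Ls.
  by move=> ->.
Qed.

(** A path without repeated vertices in a window of [n] integers has fewer than [n] edges. *)
Lemma linked_short lo (n : nat) u v : linked lo (lo + n%:Z) u v ->
  exists p, [/\ path e u p, last u p = v & (size p <= n)%N].
Proof.
move=> [p [Pp Lp /allP Ap]]; case/shortenP: Pp Lp => q Pq Uq Sq Lq.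
exists q; split => //; apply: ltnW; apply: (uniq_window_size lo _ (u :: q)) => // w.
move=> Hw; apply: Ap; move: Hw; rewrite !inE => /predU1P[->|/Sq ->];
  by rewrite ?eqxx ?orbT.
Qed.

(** * Bounded return to [V i] in a recurrent graph *)

Variables (I : Type) (W : int -> Prop) (V : I -> int -> Prop).
Hypothesis W_edge : forall u v, e u v -> W u -> W v.
Hypothesis VW : forall i u, V i u -> W u.
Hypothesis exhaust : forall lo hi, exists i,
  V i 0 /\ forall u, in_window lo hi u -> W u -> V i u.
(** For [V i] only one direction is asked: membership will be an open condition, non-membership need
    not be. *)
Hypothesis recurrent : forall i lo hi, exists L : nat, forall a, exists t,
  [/\ a <= lo + t <= a + L%:Z,
      forall u v, in_window lo hi u -> in_window lo hi v ->
        e (u + t) (v + t) = e u v &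
      forall u, in_window lo hi u -> V i u -> V i (u + t)].

Lemma W_path u p : path e u p -> W u <-> W (last u p).
Proof.
elim: p u => //= y p IH u /andP[Huy /IH <-].
by split; apply: W_edge; rewrite // e_sym.
Qed.

Lemma bounded_return : exists i (n : nat), forall m p,
  path e m p -> last m p = 0 ->
  exists q, [/\ path e m q, (size q <= n)%N & V i (last m q)].
Proof.
have [k Bk [lo [hi [Hlh Nk]]]] : exists2 k,
    (forall lo hi, lo + D <= hi -> strands lo hi W k) &
    exists lo hi, lo + D <= hi /\ ~ strands lo hi W k.+1.
  apply: contrapT => H.
  have B k : forall lo hi, lo + D <= hi -> strands lo hi W k.
    elim: k => [|k IH] lo hi Hlh; first by exists [::].
    by apply: contrapT => N; apply: H; exists k => //; exists lo, hi.
  (* More than [D] strands never fit, so a maximal [k] exists. *)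
  by have /strands_bounded := B `|D|.+1 0 D ltac:(lia); rewrite ltnn.
have [i [Vi0 Vi]] := exhaust lo hi.
have [L HL] := recurrent i lo hi.
pose Q : nat := (L + `|hi - lo|)%N.
(* By recurrence a long window contains a translate of [lo, hi), which has no
   k + 1 strands. *)
have long a b : a + Q%:Z <= b -> ~ strands a b (V i) k.+1.
  move=> Hab Hs; have [t [Ht He HV]] := HL a; apply: Nk.
  have : strands lo hi (V i) k.+1.
    apply: (@strands_translate lo hi t) => //.
    by apply: strands_sub Hs; lia.
  move=> [s [Ss Us Cs As Ls]]; exists s; split => // u v us L' Wv.
  by apply: (As u v us L'); apply: Vi => //; case: (linked_in _ _ _ _ L').
(* The window will be [[m - Q, m + Q + 1)]: each half, with [m] included, is long enough for
   [long]. *)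
pose n : nat := (Q + Q.+1)%N.
exists i, n => m p Pp Lp.
suff [v Hv Vv] : exists2 v, linked (m - Q%:Z) (m - Q%:Z + n%:Z) m v & V i v.
  by have [q [Pq Lq Sq]] := linked_short _ _ _ _ Hv; exists q; rewrite Lq.
set lo' := m - Q%:Z; set hi' := lo' + n%:Z.
have Hm : in_window lo' hi' m by rewrite /in_window; lia.
(* Either the path reaches [0], a point of [V i], inside the window, or it comes within [D] of an
   end. *)
case: (path_exit _ _ _ _ Pp Hm) => [|[v Lmv Hv]].
  by rewrite Lp; exists 0.
have Wm : W m by apply/(W_path _ _ Pp); rewrite Lp; apply: VW Vi0.
(* Depending on that end, the strand crosses the upper half [[m, hi')] or the lower half
   [[lo', m + 1)]. *)
have [a [b [u [Hab Ha Hb Cu Lmu]]]] : exists a b u,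
    [/\ a + Q%:Z <= b, lo' <= a, b <= hi', crossing a b u & linked lo' hi' m u].
  case/orP: Hv => Hv.
    have [q [Pq Lq /allP Aq]] := Lmv.
    have Hl : m <= last m q by lia.
    have [u' [r [Pr Lr /allP Ar Sr H]]] := path_cut_low _ _ _ Pq Hl.
    have Lu : linked m hi' u' v.
      exists r; split => //; first by rewrite Lr.
      by apply/allP => w Hw; move: (Ar _ Hw) (Aq _ (Sr _ Hw)); rewrite /in_window; lia.
    exists m, hi', u'; split; try lia.
      by split; [case: H => [[-> _]|]; lia|exists v].
    apply: linked_trans Lmv _; apply: linked_sym; apply: linked_sub Lu => //.
    by lia.
  have [q [Pq Lq /allP Aq]] := linked_sym Lmv.
  have Hv' : v < m + 1 by lia.
  have Hl : m + 1 - D <= last v q by lia.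
  have [r [Pr Lr /allP Ar Sr]] := path_cut_high _ _ _ Pq Hv' Hl.
  exists lo', (m + 1), v; split => //; try lia.
  split => //; exists (last v r) => //; exists r; split => //.
  apply/allP => w Hw; have /= := Ar _ Hw; have := Aq _ (Sr _ Hw).
  by rewrite /in_window; lia.
(* If nothing in [V i] is linked to [m], then [u] starts a further strand: it lies in [W], which the
   [k] given strands avoid, so it is linked to none of them. *)
apply: contrapT => N; apply: (long a b Hab).
have [s [Ss Us Cs As Ls]] : strands a b W k by apply: Bk; lia.
have Wu : W u by have [q [Pq <- _]] := Lmu; exact/(W_path _ _ Pq).
have us v' : v' \in s -> ~ linked a b v' u.
  by move=> vs /(As _ _ vs).
exists (u :: s); split => //=.
- by rewrite Ss.
- rewrite Us andbT; apply/negP => /[dup] us' /us; apply.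
  by case: Cu => _ [? _ /linked_in[Hu _]]; exact: linked_refl.
- by move=> w; rewrite inE => /predU1P[->|/Cs].
- move=> w z; rewrite inE => /predU1P[->|ws] L' Vz; last first.
    by apply: (As _ _ ws L'); exact: VW Vz.
  by apply: N; exists z => //; apply: linked_trans Lmu _; exact: linked_sub L'.
- move=> w z; rewrite !inE => /predU1P[->|ws] /predU1P[->|zs] // L'.
  + by case: (us _ zs (linked_sym L')).
  + by case: (us _ ws L').
  + exact: Ls.
Qed.

End Strands.

(** * Finite generation of virtually polycyclic groups, and integer powers *)

Section FiniteGeneration.
Local Open Scope group_scope.
Context {T : groupType}.
Implicit Types (S A : seq T) (G N H : set T).

(** The generated submonoid: inverses must be listed in [S], so that induction on words has a single
    step. *)
Inductive span S : T -> Prop :=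
| span1 : span S 1
| spanM s g : s \in S -> span S g -> span S (s * g).

Definition finitely_generated G : Prop :=
  exists S, [set` S] `<=` G /\ G `<=` span S.

Lemma span_mul S g h : span S g -> span S h -> span S (g * h).
Proof.
by elim=> [|s g' Ss _ IH] Sh; rewrite ?mul1g // -mulgA; apply: spanM => //; exact: IH.
Qed.

Lemma span_subset S A : {subset S <= A} -> span S `<=` span A.
Proof.
move=> SA g; elim=> [|s {}g Ss _ IH]; first exact: span1.
by apply: spanM => //; exact: SA.
Qed.

(** Covers both extensions below: by a cyclic factor and by finitely many cosets. *)
Lemma finitely_generated_ext N G A :
  N `<=` G -> finitely_generated N -> [set` A] `<=` G ->
  (forall g, G g -> exists a n, [/\ span A a, N n & g = a * n]) ->
  finitely_generated G.
Proof.
move=> NG [S [SN NS]] AG H; exists (A ++ S); split.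
  by move=> s /=; rewrite mem_cat => /orP[/AG|/SN/NG].
move=> g /H[a [n [Aa /NS Sn ->]]]; apply: span_mul.
  by apply: span_subset Aa => s; rewrite mem_cat => ->.
by apply: span_subset Sn => s; rewrite mem_cat orbC => ->.
Qed.

Lemma expgz_span (g : T) (k : int) : span [:: g; g^-1] (expgz g k).
Proof.
have P (h : T) n : h \in [:: g; g^-1] -> span [:: g; g^-1] (h ^+ n).
  move=> Hh; elim: n => [|n IH]; first exact: span1.
  by rewrite expgS; exact: spanM.
by case: k => n /=; rewrite -?expVgn; apply: P; rewrite !inE eqxx ?orbT.
Qed.

(** Climbing the series, each element of [H i.+1] is a power of one fixed element times an element
    of [H i]. *)
Lemma polycyclic_finitely_generated G : polycyclic G -> finitely_generated G.
Proof.
move=> [_ [n [H [H0 <- Hstep]]]].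
suff: forall i, (i <= n)%N -> finitely_generated (H i) by apply.
elim=> [_|i IH Hi].
  by exists [::]; rewrite H0; split=> [//|g ->]; exact: span1.
have [[_ _ HV] [_ sub _] [g Gg E]] := Hstep i Hi.
apply: (@finitely_generated_ext (H i) _ [:: g; g^-1]) => //.
- exact: IH (ltnW Hi).
- by move=> h /=; rewrite !inE => /orP[]/eqP-> //; exact: HV.
move=> h Gh.
have : left_cosets (H i) (H i.+1) (left_coset h (H i)) by exists h.
rewrite E => -[k _ Ek].
have : left_coset h (H i) h.
  exists 1; last by rewrite mulg1.
  by have [_ /(_ i)] := conj I Hstep; move=> /(_ Hi)[_ [[]]].
rewrite -Ek => -[m Hm <-]; exists (expgz g k), m; split => //.
exact: expgz_span.
Qed.

Lemma virtually_polycyclic_finitely_generated G :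
  virtually_polycyclic G -> finitely_generated G.
Proof.
move=> [SG [H [HG pH]]].
have [[H1 _ _] _] := pH.
move=> /finite_seqP[C EC].
have /choice[r Hr] : forall A : set T, exists g, left_cosets H G A ->
    G g /\ A = left_coset g H.
  move=> A; have [[g Gg <-]|N] := pselect (left_cosets H G A).
    by exists g.
  by exists 1.
apply: (@finitely_generated_ext H G (map r C)) => //.
- exact: polycyclic_finitely_generated.
- move=> _ /= /mapP[A AC ->]; apply: (Hr A _).1.
  by rewrite EC.
move=> g Gg.
have Lg : left_cosets H G (left_coset g H) by exists g.
have [_ E] := Hr _ Lg.
have : left_coset g H g by exists 1; rewrite ?mulg1.
rewrite {1}E => -[h Hh <-]; exists (r (left_coset g H)), h; split => //.
rewrite -[r _]mulg1; apply: spanM; last exact: span1.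
by apply: map_f; move: Lg; rewrite EC.
Qed.

Lemma expgzS (g : T) (k : int) : expgz g (k + 1)%R = g * expgz g k.
Proof.
case: k => n; first by rewrite -[(_ + _)%R]/(Posz (n + 1)) addn1 /= expgS.
case: n => [|n]; first by rewrite /= expg1 mulgV.
rewrite (_ : (Negz n.+1 + 1)%R = Negz n); last by lia.
by rewrite /= [X in _ * X^-1]expgSr invgM mulgA mulgV mul1g.
Qed.

Lemma expgzD (g : T) (k l : int) : expgz g (k + l)%R = expgz g k * expgz g l.
Proof.
have pred (i : int) : expgz g (i - 1)%R = g^-1 * expgz g i.
  by rewrite -[in RHS](subrK 1%R i) expgzS mulgA mulVg mul1g.
elim/int_rec: k => [|n IH|n IH]; first by rewrite add0r mul1g.
  by rewrite -addn1 PoszD expgzS -mulgA -IH -expgzS; congr expgz; lia.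
have -> : (- n.+1%:Z)%R = (- n%:Z - 1)%R by lia.
by rewrite pred -mulgA -IH -pred; congr expgz; lia.
Qed.

End FiniteGeneration.

(** * Return times and bounded cocycles along an orbit of [f] *)

Section CyclicReturns.
Local Open Scope ring_scope.
Context {X : topologicalType}.
Implicit Types (f g : homeo X) (c : X -> int) (x : X).

Lemma nbhs_seq {I : eqType} (s : seq I) x (P : I -> X -> Prop) :
  (forall i, i \in s -> \forall y \near x, P i y) ->
  \forall y \near x, forall i, i \in s -> P i y.
Proof.
elim: s => [|i s IH] H; first exact: nearW.
have Hi := H i (mem_head _ _).
have Hs : \forall y \near x, forall j, j \in s -> P j y.
  by apply: IH => j js; apply: H; rewrite inE js orbT.
by apply: filterS2 Hi Hs => y Hi Hs j; rewrite inE => /predU1P[->|/Hs].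
Qed.

Lemma near_homeo f x (P : X -> Prop) :
  (\forall y \near f x, P y) -> \forall y \near x, P (f y).
Proof. exact: homeo_fun_continuous. Qed.

Lemma locally_constant_bounded c (K : set X) :
  locally_constant c -> compact K ->
  exists B : nat, forall y, K y -> (`|c y| <= B)%N.
Proof.
move=> cc /compact_near_coveringP cK.
have : \forall B \near \oo, K `<=` [set y | (`|c y| <= B)%N].
  apply: (cK nat \oo (fun B y => (`|c y| <= B)%N)) => y Ky.
  near=> z B => /=.
  have -> : c z = c y by near: z; exact: cc.
  by near: B; exact: nbhs_infty_ge.
by move=> [B _ HB]; exists B => y Ky; exact: (HB B (leqnn B) y Ky).
Unshelve. all: by end_near. Qed.

Lemma return_times f x (V : set X) :
  almost_periodic_at (cyclic_subgroup f) x -> nbhs x V ->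
  exists M : nat, forall k : int, exists t,
    [/\ k <= t <= k + M%:Z & V (expgz f t x)].
Proof.
move=> ap /ap[_ [F [/finite_seqP[s ->] sub E]]].
have /choice[j Hj] : forall a : homeo X, exists i, a \in s -> a = expgz f i.
  move=> a; have [/sub[i _ <-]|] := boolP (a \in s); first by exists i.
  by exists 0.
(* Every translating element is some [f^j] with [|j| <= M]; aiming at time [k + M] and undoing [f^j]
   gives a time in [[k, k + 2M]]. *)
pose M := (\max_(a <- s) `|j a|)%N.
exists (M + M)%N => k.
have : cyclic_subgroup f (expgz f (k + M%:Z)) by exists (k + M%:Z).
rewrite E => -[a as_ [g [_ Vg] Eg]].
have Ma : (`|j a| <= M)%N.
  by rewrite /M; apply: (leq_bigmax_seq (F := fun b => `|j b|%N)).
exists (- j a + (k + M%:Z)); split; first by lia.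
have ja : (expgz f (- j a) * a)%g = 1%g by rewrite {2}(Hj a as_) -expgzD addNr.
by rewrite expgzD -Eg mulgA ja mul1g.
Qed.

(** Syndeticity covers the orbit by finitely many translates [a K] of a compact neighbourhood [K] of
    [x], and [c] is bounded on each. *)
Lemma cocycle_bounded f x c : locally_compact [set: X] ->
  almost_periodic_at (cyclic_subgroup f) x -> locally_constant c ->
  exists B : nat, forall n : int, (`|c (expgz f n x)| <= B)%N.
Proof.
move=> lcX ap cc.
have [K nK [cK _]] : exists2 K, nbhs x K & compact K /\ closed K.
  by have := lcX x I; rewrite withinET.
have [_ [F [/finite_seqP[s ->] sub E]]] := ap K nK.
have /choice[B HB] : forall a : homeo X, exists B : nat,
    forall y, K y -> (`|c (a y)| <= B)%N.
  move=> a; apply: locally_constant_bounded => // y.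
  exact: (near_homeo a y (fun z => c z = c (a y)) (cc (a y))).
exists (\max_(a <- s) B a)%N => n.
have : cyclic_subgroup f (expgz f n) by exists n.
rewrite E => -[a as_ [g [_ Kg] <-]].
by rewrite homeo_mulE (leq_trans (HB a _ Kg)) // (leq_bigmax_seq (F := B)).
Qed.

End CyclicReturns.

(** * Words of bounded length, and the passage from the orbit graph to the group *)

Section Ball.
Local Open Scope group_scope.
Context {T : groupType}.

(** New letters go on the right, where they act first, to match the first edge of a path. *)
Fixpoint ball (S : seq T) (k : nat) : seq T :=
  if k is k'.+1 then
    ball S k' ++ [seq h * s | h <- ball S k', s <- S ++ map (fun s => s^-1) S]
  else [:: 1].

Lemma ball_mono S k l : (k <= l)%N -> {subset ball S k <= ball S l}.
Proof.
move=> /subnK <-; elim: (l - k)%N => // n IH h /IH Hh.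
by rewrite addSn /= mem_cat Hh.
Qed.

Lemma ball_sub S (G : set T) k : subgroup G -> [set` S] `<=` G ->
  [set` ball S k] `<=` G.
Proof.
move=> [G1 GM GV] SG; elim: k => [|k IH] h /=; first by rewrite inE => /eqP->.
rewrite mem_cat => /orP[/IH//|/allpairsP[[a b] /= [/IH Ga + ->]]].
rewrite mem_cat => Hb; apply: GM => //.
by case/orP: Hb => [/SG//|/mapP[s /SG Gs ->]]; exact: GV.
Qed.

End Ball.

(** By [bounded_return], a short path leads from the index of [g x] into [V T]; it spells a short
    word, after which one of the finitely many elements of [T] moves the point into [U]. *)
Theorem finitely_generated_almost_periodic (X : topologicalType) (f : homeo X)
  (G : set (homeo X)) (x : X) :
  locally_compact [set: X] -> almost_periodic_at (cyclic_subgroup f) x ->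
  subgroup G -> G `<=` topological_full_group f -> finitely_generated G ->
  almost_periodic_at G x.
Proof.
move=> lcX ap SG Gf [S [SsG GS]] U nU.
have [G1 GM GV] := SG.
split; first by move=> g [].
have /choice[c Hc] : forall s : homeo X, exists c : X -> int, G s ->
    locally_constant c /\ forall y, s y = expgz f (c y) y.
  move=> s; have [/Gf[c c1 c2]|N] := pselect (G s); first by exists c.
  by exists (fun=> 0%R).
pose o (n : int) : X := expgz f n x.
have oS s n : s \in S -> s (o n) = o (n + c s (o n))%R.
  by move=> /SsG/Hc[_ ->]; rewrite addrC /o expgzD.
(* Vertices are integers rather than orbit points, since [o] need not be injective. *)
pose e : rel int := fun n m => `[< exists2 s, s \in S &
  m = (n + c s (o n))%R \/ n = (m + c s (o m))%R >].
have e_sym : symmetric e.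
  by move=> n m; apply: asbool_equiv_eq; split=> -[s ss H]; exists s => //;
    case: H; [right|left|right|left].
have e_step n m : e n m -> exists2 h,
    h \in S ++ map (fun s : homeo X => s^-1)%g S & o m = h (o n).
  move=> /asboolP[s ss [E|E]].
    by exists s; rewrite ?mem_cat ?ss // oS -?E.
  exists s^-1%g; first by rewrite mem_cat map_f ?orbT.
  by rewrite E -oS // -homeo_mulE mulVg.
have /choice[B HB] : forall s, exists B : nat, s \in S ->
    forall n : int, (`|c s (o n)| <= B)%N.
  move=> s; have [/SsG/Hc[cs _]|_] := boolP (s \in S); last by exists 0.
  by have [B HB] := cocycle_bounded f x _ lcX ap cs; exists B.
(* The successor keeps [D] positive even if all jumps vanish. *)
pose D : int := ((\max_(s <- S) B s).+1)%:Z.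
have D_gt0 : (0 < D)%R by [].
have e_bounded u v : e u v -> (u - D <= v <= u + D)%R.
  move=> /asboolP[s ss H].
  have Bs : (B s <= \max_(s <- S) B s)%N by apply: leq_bigmax_seq.
  by have := HB s ss u; have := HB s ss v; rewrite /D; case: H => ->; lia.
(* The interior of [U] makes membership an open condition, for the sake of recurrence. *)
pose V (T : seq (homeo X)) n := exists g, [/\ g \in T, G g & U° (g (o n))].
pose W n := exists2 g, G g & U° (g (o n)).
have VW T u : V T u -> W u by move=> [g [_ Gg Ug]]; exists g.
have W_edge u v : e u v -> W u -> W v.
  rewrite e_sym => /e_step[h hS E] [g Gg Ug]; exists (g * h)%g; last first.
    by rewrite homeo_mulE -E.
  apply: GM => //; move: hS; rewrite mem_cat => /orP[/SsG//|/mapP[s /SsG Gs ->]].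
  exact: GV.
have Ux : U° (o 0%R) by exact: nbhs_singleton (nbhs_interior nU).
have exhaust lo hi : exists T, V T 0%R /\
    forall u, in_window lo hi u -> W u -> V T u.
  have /choice[g Hg] : forall u, exists g, W u -> G g /\ U° (g (o u)).
    by move=> u; have [[g Gg Ug]|N] := pselect (W u); [exists g|exists 1%g].
  have [w mw] := window_enum lo hi.
  (* The identity puts [0] into [V T], as [x] is interior to [U]. *)
  exists (1%g :: map g w); split; first by exists 1%g; rewrite inE eqxx.
  move=> u /mw uw /Hg[Gg Ug]; exists (g u); split=> //.
  by rewrite inE map_f ?orbT.
have recurrent T lo hi : exists L : nat, forall a, exists t,
    [/\ (a <= lo + t <= a + L%:Z)%R,
      forall u v, in_window lo hi u -> in_window lo hi v ->
        e (u + t)%R (v + t)%R = e u v &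
      forall u, in_window lo hi u -> V T u -> V T (u + t)%R].
  have [w mw] := window_enum lo hi.
  (* Points [z] near [x] show the jumps of [x] throughout the window and keep its visits to [U];
     when [f^t x] is such a point, the pattern recurs at shift [t]. *)
  have nV : \forall z \near x, forall u, u \in w ->
      (forall s, s \in S -> c s (expgz f u z) = c s (o u)) /\
      (forall g, g \in T -> U° (g (o u)) -> U° (g (expgz f u z))).
    apply: (nbhs_seq w) => u _; apply: filterS2; last first.
    - apply: (nbhs_seq T) => g _.
      apply: (near_homeo (g * expgz f u)%g x (fun z => U° (g (o u)) -> U° z)).
      have [Ug|N] := pselect (U° (g (o u))); last by apply: nearW => z /N.
      by have := open_nbhs_nbhs (conj (open_interior U) Ug); apply: filterS.
    - apply: (nbhs_seq S) => s ss.
      apply: (near_homeo (expgz f u) x (fun z => c s z = c s (o u))).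
      exact: (Hc s (SsG s ss)).1.
    - by [].
  have [M HM] := return_times f x _ ap nV.
  exists M => a; have [t [Ht Vt]] := HM (a - lo)%R.
  have ot u : expgz f u (expgz f t x) = o (u + t)%R by rewrite /o expgzD.
  exists t; split; first by lia.
    move=> u v /mw uw /mw vw; apply: asbool_equiv_eq.
    have Cu s : s \in S -> c s (o (u + t)%R) = c s (o u).
      by move=> ss; rewrite -ot (Vt u uw).1.
    have Cv s : s \in S -> c s (o (v + t)%R) = c s (o v).
      by move=> ss; rewrite -ot (Vt v vw).1.
    by split=> -[s ss H]; exists s => //; move: H; rewrite Cu ?Cv //;
      (case=> H; [left|right]; lia).
  move=> u /mw uw [g [gT Gg Ug]]; exists g; split=> //.
  by rewrite -ot; apply: (Vt u uw).2.
have [T [n Hn]] := bounded_return _ _ e_sym e_bounded D_gt0 _ _ _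
  W_edge VW exhaust recurrent.
have path_ball m p k : path e m p -> (size p <= k)%N ->
    exists2 h, h \in ball S k & o (last m p) = h (o m).
  elim: p m k => [|y p IH] m k /=.
    by move=> _ _; exists 1%g => //; apply: (ball_mono S 0 k) => //; rewrite inE.
  case: k => // k /andP[/e_step[s sS E] /IH/[apply] -[h hB ->]].
  exists (h * s)%g; last by rewrite homeo_mulE E.
  by rewrite /= mem_cat; apply/orP; right; apply/allpairsP; exists (h, s).
(* The path runs from [g x] back to [x], adding an edge in front for each letter of the word. *)
have orbit_path g : G g -> exists m p,
    [/\ path e m p, last m p = 0%R & o m = g x].
  move=> /GS; elim=> [|s {}g ss _ [m [p [Pp Lp E]]]].
    by exists 0%R, [::].
  exists (m + c s (o m))%R, (m :: p); split=> //=.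
    by rewrite Pp andbT; apply/asboolP; exists s => //; right.
  by rewrite -oS // E.
(* Once [a h g x] lies in [U], write [g] as [(a h)^-1] times [a h g]. The condition [G k] is there
   because [T] may contain elements outside [G]. *)
exists [set k | G k /\ exists a h, [/\ a \in T, h \in ball S n & k = (a * h)^-1%g]].
split.
- apply: (@sub_finite_set _ _ [set` [seq (a * h)^-1%g | a <- T, h <- ball S n]]).
    by move=> _ [_ [a [h [aT hB ->]]]]; apply/allpairsP; exists (a, h).
  by apply/finite_seqP; eexists.
- by move=> k [].
apply/seteqP; split=> [g Gg|_ [k [Gk _] [s [Gs _] <-]]]; last exact: GM.
have [m [p [Pp Lp E]]] := orbit_path g Gg.
have [q [Pq Sq [a [aT Ga Ua]]]] := Hn m p Pp Lp.
have [h hB Eh] := path_ball m q n Pq Sq.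
have Gh : G h by exact: ball_sub hB.
exists (a * h)^-1%g; first by split; [exact: (GV _ (GM _ _ Ga Gh))|exists a, h].
exists (a * h * g)%g; last by rewrite mulgA mulVg mul1g.
split; first exact: (GM _ _ (GM _ _ Ga Gh) Gg).
by apply: interior_subset; rewrite !homeo_mulE -E -Eh.
Qed.

Theorem corollary1p5 (X : topologicalType)
  (locally_compact_X : locally_compact [set: X])
  (hausdorff_X : hausdorff_space X)
  (f : homeo X)
  (f_pap : pointwise_almost_periodic (cyclic_subgroup f))
  (G : set (homeo X))
  (G_subgroup : subgroup G)
  (G_sub_tau : G `<=` topological_full_group f)
  (G_vpc : virtually_polycyclic G) :
  pointwise_almost_periodic G.
Proof.
move=> x; apply: (finitely_generated_almost_periodic _ f) => //.
exact: virtually_polycyclic_finitely_generated.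
Qed.
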